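(* Let $v_1,\ldots,v_n\in\mathbb{Z}^2$ be pairwise linearly independent and let $\mathcal{A}$ be the corresponding toric arrangement with special vertex. Write $v_i=(a_i,b_i)$ and assume that $\gcd(a_i,b_i)=1$ for all $i=1,\ldots,n$. If $\mathcal{A}$ is simplicial, then $n\le 12$.
   Context: Let $e_1,e_2,e_3$ be the standard basis of $\mathbb{R}^3$ and identify $\mathbb{R}^2$ with $\langle e_1,e_2\rangle\subset\mathbb{R}^3$. For $v\in\mathbb{R}^3$, $v^\perp$ denotes the orthogonal complement of $v$ with respect to the standard inner product. The toric arrangement with special vertex corresponding to $v_1,\ldots,v_n\in\mathbb{Z}^2$ is the (infinite) set of planes in $\mathbb{R}^3$ $$\mathcal{A}=\{(v_i+k e_3)^\perp \mid i=1,\ldots,n,\ k\in\mathbb{Z}\}\cup\{e_3^\perp\}.$$ It is called simplicial if the connected components of the complement of (the union of the planes of) $\mathcal{A}$ in the open half space $\{(x_1,x_2,x_3)\in\mathbb{R}^3\mid x_3>0\}$ are open simplicial cones (an open simplicial cone in $\mathbb{R}^3$ is the set of all strictly positive linear combinations of some basis of $\mathbb{R}^3$). *)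

(* Defs.v *)
From HB Require Import structures.
From mathcomp Require Import all_boot all_order all_algebra.
From mathcomp Require Import boolp classical_sets reals topology normedtype.

Set Implicit Arguments.
Unset Strict Implicit.
Unset Printing Implicit Defensive.

Import Order.TTheory GRing.Theory Num.Theory.
Import numFieldNormedType.Exports.
Local Open Scope classical_set_scope.
Local Open Scope ring_scope.

Section ToricArrangement.
Variable R : realType.

Definition real_vec (m : nat) (v : 'rV[int]_m) : 'rV[R]_m := map_mx intr v.

Definition plane_to_space (x : 'rV[R]_2) : 'rV[R]_3 := row_mx x (0 : 'rV[R]_1).

Definition e3 : 'rV[R]_3 := delta_mx 0 ord_max.

Definition inner (x y : 'rV[R]_3) : R := \sum_i x 0 i * y 0 i.

Definition orthogonal_complement (v : 'rV[R]_3) : set 'rV[R]_3 :=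
  [set x | inner x v = 0].

Definition toric_arrangement (n : nat) (v : 'I_n -> 'rV[int]_2) :
    set (set 'rV[R]_3) :=
  [set H | exists i k, H = orthogonal_complement
             (plane_to_space (real_vec (v i)) + k%:~R *: e3)]
  `|` [set orthogonal_complement e3].

Definition upper_half_space : set 'rV[R]_3 := [set x | 0 < x 0 ord_max].

Definition arrangement_complement (A : set (set 'rV[R]_3)) : set 'rV[R]_3 :=
  upper_half_space `\` \bigcup_(H in A) H.

Definition open_simplicial_cone (C : set 'rV[R]_3) : Prop :=
  exists b : 3.-tuple 'rV[R]_3, basis_of fullv b /\
    C = [set x | exists c : 'I_3 -> R,
           (forall i, 0 < c i) /\ x = \sum_i c i *: tnth b i].

(* The topology on ['rV[R]_3] is the product topology, i.e. the usual one. *)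
Definition simplicial (A : set (set 'rV[R]_3)) : Prop :=
  forall x, arrangement_complement A x ->
    open_simplicial_cone (connected_component (arrangement_complement A) x).

Definition pairwise_lin_indep (n : nat) (v : 'I_n -> 'rV[int]_2) : Prop :=
  forall i j, i != j -> free [:: real_vec (v i); real_vec (v j)].

End ToricArrangement.

Arguments pairwise_lin_indep R {n} v.
Arguments toric_arrangement R {n} v.

(* Main.v *)
Require Import Defs.
From HB Require Import structures.
From mathcomp Require Import all_boot all_order all_algebra zify ring lra.
From mathcomp Require Import boolp classical_sets reals topology normedtype.

Set Implicit Arguments.
Unset Strict Implicit.
Unset Printing Implicit Defensive.

Import Order.TTheory GRing.Theory Num.Theory.
Import numFieldNormedType.Exports.
Local Open Scope classical_set_scope.
Local Open Scope ring_scope.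

(** The section of the arrangement by the plane of height 1 is, up to a quarter
    turn, the arrangement of the lines [det x u = k], where [u] runs through the
    set [V] of the vectors [v i] and their opposites and [k] through the
    integers. All directions of [V] meet at the origin. The arrangement is used
    only through the following consequence of being simplicial: two vertices
    that no line strictly separates lie on a common line, as they are vertices
    of one triangle ([triangular_of_simplicial]).

    The argument looks at the cells around the origin. The first vertex on the
    ray of [v] is [v / m], where [m] is the maximum of [det v] on [V], and the
    first vertices on adjacent rays are joined by a line whose normal reaches
    both maxima ([common_support]). Call [v] simple if the maximum is reached
    only once, so that just two lines cross at its first vertex. The four cells
    at such a crossing form a quadrilateral. This implies that simple directions
    are not adjacent ([simple_not_adjacent]), and that the second largest value
    of [det v] is reached at two vectors, supporting the two neighbours of [v],
    whose difference is a positive integer multiple of [v] ([simple_chord]).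

    Choose [a] and [b] in [V] with [det a b] maximal. If the maximum of [det a]
    or of [det b] is reached twice, the convex hull of [V] is a hexagon with
    vertices [a], [a + b], [b] and their opposites (after a change of [b]). Then
    the directions between consecutive vertices are all simple, so there is at
    most one in each of the three sectors, and [n <= 6] ([hexagon_case]).

    Otherwise [a] and [b] are simple, and by maximality the integer multiples at
    [a] and at [b] are equal to 1: there are [g] and [g + a] at the second height
    over [a], and [k] and [k - b] at the second height over [b]. This leaves at
    most five directions between [a] and [b], which are [x1], [b - k], the
    direction of [k - g], [g + a] and [x2] for suitable [x1] and [x2]
    ([sector_le5]). The same holds between [b] and [- a], whence
    [n <= 2 + 5 + 5]. *)

(** * Determinants in the plane *)
Definition vec := (int * int)%type.

Definition det (x y : vec) : int := x.1 * y.2 - x.2 * y.1.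

Lemma detC x y : det x y = - det y x.
Proof. rewrite /det; ring. Qed.

Lemma detxx x : det x x = 0.
Proof. rewrite /det; ring. Qed.

Lemma detDr x y z : det x (y + z) = det x y + det x z.
Proof. rewrite /det /=; ring. Qed.

Lemma detNr x y : det x (- y) = - det x y.
Proof. rewrite /det /=; ring. Qed.

Lemma detDl x y z : det (x + y) z = det x z + det y z.
Proof. rewrite /det /=; ring. Qed.

Lemma detNl x y : det (- x) y = - det x y.
Proof. rewrite /det /=; ring. Qed.

Lemma detZr x y s : det x (y *~ s) = s * det x y.
Proof. rewrite /det (raddfMz fst) (raddfMz snd) /= !mulrzz; ring. Qed.

Lemma detZl x y s : det (x *~ s) y = s * det x y.
Proof. by rewrite detC detZr (detC y); ring. Qed.

Definition detE := (detDr, detDl, detNr, detNl, detZr, detZl, detxx).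

(** The Plücker relation. For [det a b != 0] it computes [det x y] from the
    coordinates of [x] and [y] in the basis [a], [b]. *)
Lemma plucker a b x y :
  det a b * det x y = det x b * det a y - det a x * det y b.
Proof. rewrite /det; ring. Qed.

Lemma det_inj a b x y :
  det a b != 0 -> det a x = det a y -> det x b = det y b -> x = y.
Proof.
move=> ab0 hY hX; apply/eqP; rewrite -subr_eq0; apply/eqP.
have hYd : det a (x - y) = 0 by rewrite !detE hY subrr.
have hXd : det (x - y) b = 0 by rewrite !detE hX subrr.
move: (x - y) hYd hXd => [u w]; rewrite /det /= => h1 h2.
have hu : det a b * u = 0.
  have -> : det a b * u = a.1 * (u * b.2 - w * b.1) + b.1 * (a.1 * w - a.2 * u)
    by rewrite /det; ring.
  by rewrite h1 h2 !mulr0 addr0.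
have hw : det a b * w = 0.
  have -> : det a b * w = a.2 * (u * b.2 - w * b.1) + b.2 * (a.1 * w - a.2 * u)
    by rewrite /det; ring.
  by rewrite h1 h2 !mulr0 addr0.
by move/eqP: hu; move/eqP: hw; rewrite !mulf_eq0 (negbTE ab0) /= => /eqP-> /eqP->.
Qed.

(** * Arrangements with triangular cells *)

(** The pair [(v, m)] with [0 < m] stands for the rational point [v / m], so
    that the incidence of points and lines is an integer condition. *)
Definition rat_point := (vec * int)%type.

Definition on_line (P : rat_point) (u : vec) (k : int) := det P.1 u = k * P.2.

Definition strictly_below (P : rat_point) (u : vec) (k : int) := det P.1 u < k * P.2.

Definition strictly_above (P : rat_point) (u : vec) (k : int) := k * P.2 < det P.1 u.

Definition is_vertex (V : seq vec) (P : rat_point) :=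
  exists u k u' k', [/\ u \in V, u' \in V, det u u' != 0,
    on_line P u k & on_line P u' k'].

(** Two vertices of a triangle are joined by a side, whereas a cell with more
    sides has diagonals: the cells are triangles when any two vertices that no
    line strictly separates lie on a common line. *)
Definition triangular_cells (V : seq vec) :=
  forall P Q : rat_point, 0 < P.2 -> 0 < Q.2 -> is_vertex V P -> is_vertex V Q ->
  exists u k, u \in V /\ ((on_line P u k /\ on_line Q u k) \/
    (strictly_below P u k /\ strictly_above Q u k)).

Record simplicial_normals (V : seq vec) : Prop := SimplicialNormals {
  normals_opp : forall x, x \in V -> - x \in V;
  normals_parallel : forall x y, x \in V -> y \in V -> det x y = 0 ->
    x = y \/ x = - y;
  normals_primitive : forall x y, x \in V -> det x y = 0 -> exists s, y = x *~ s;
  normals_triangular : triangular_cells V }.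

(** The first vertex met on the ray of [v] is [v / m], where [m] is the largest
    [det v u]; the other lines through this vertex are those of the [u] that
    support [v], that is, of the vectors of [V] on one face of its convex hull. *)
Definition supports (V : seq vec) (v u : vec) : Prop :=
  u \in V /\ forall z, z \in V -> det v z <= det v u.

Definition adjacent (V : seq vec) (v w : vec) : Prop :=
  0 < det v w /\ forall z, z \in V -> 0 < det v z -> det z w <= 0.

(** Exactly two lines cross at the first vertex on the ray of [v]: the line
    carrying the ray and the one of its only support. *)
Definition simple_dir (V : seq vec) (v : vec) : Prop :=
  forall u u', supports V v u -> supports V v u' -> u = u'.

Lemma max_exists (T : eqType) (V : seq T) (f : T -> int) x0 : x0 \in V ->
  exists2 u, u \in V & forall z, z \in V -> f z <= f u.
Proof.
elim: V x0 => [//|x V IH] x0 _; case: V IH => [|y V] IH.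
  by exists x => [|z]; rewrite !inE // => /eqP->.
have [u uV umax] := IH y (mem_head _ _).
have [le|lt] := leP (f x) (f u).
  exists u; first by rewrite inE uV orbT.
  by move=> z; rewrite inE => /orP[/eqP->|/umax].
exists x; first exact: mem_head.
by move=> z; rewrite inE => /orP[/eqP->//|/umax h]; apply: le_trans h (ltW lt).
Qed.

Lemma support_exists V v x0 : x0 \in V -> exists u, supports V v u.
Proof. by move=> /(max_exists (det v)) [u uV h]; exists u. Qed.

Lemma support_gt0 V v w u : simplicial_normals V -> w \in V -> det v w != 0 ->
  supports V v u -> 0 < det v u.
Proof.
move=> HV wV vw [uV umax]; have := umax _ wV.
by have := umax _ (normals_opp HV wV); rewrite detE; lia.
Qed.

Lemma det_neq0_of_adjacent V v w : adjacent V v w -> det v w != 0.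
Proof. by case; lia. Qed.

Lemma adjacent_noseparate V v w z : simplicial_normals V ->
  adjacent V v w \/ adjacent V w v -> z \in V -> det v z < 0 -> 0 < det w z ->
  False.
Proof.
move=> HV [] [vw h] zV h1 h2.
  have := h _ (normals_opp HV zV); rewrite !detE (detC z w); lia.
by have := h _ zV; rewrite (detC z v); lia.
Qed.

(** The first vertices on two adjacent rays are not separated by any line, so
    the cell at the origin between these rays has its third side on a line that
    contains both. *)
Lemma common_support V v w : simplicial_normals V -> v \in V -> w \in V ->
  adjacent V v w \/ adjacent V w v -> exists2 u, supports V v u & supports V w u.
Proof.
move=> HV vV wV adj.
have vw0 : det v w != 0.
  by case: adj => /det_neq0_of_adjacent //; rewrite detC oppr_eq0.
have [u su] := support_exists v vV; have [u' su'] := support_exists w vV.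
have m0 := support_gt0 HV wV vw0 su.
have m0' : 0 < det w u' by apply: (support_gt0 HV vV _ su'); rewrite detC oppr_eq0.
have [] := normals_triangular HV (P := (v, det v u)) (Q := (w, det w u')) m0 m0'.
- exists v, 0, u, 1; split=> //=; [by case: su|lia|by rewrite /on_line detxx mul0r|].
  by rewrite /on_line mul1r.
- exists w, 0, u', 1; split=> //=; [by case: su'|lia|by rewrite /on_line detxx mul0r|].
  by rewrite /on_line mul1r.
case: su su' => uV umax [u'V u'max].
move=> z [k] [zV]; rewrite /on_line /strictly_below /strictly_above /=.
have zNV := normals_opp HV zV.
have h1 := umax _ zV; have h2 := umax _ zNV.
have h3 := u'max _ zV; have h4 := u'max _ zNV.
move: h2 h4; rewrite !detE => h2 h4.
case=> [[e1 e2]|[e1 e2]]; last first.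
  have k0 : k = 0 by nia.
  by case: (adjacent_noseparate HV adj zV); move: e1 e2; rewrite k0 !mul0r.
have : k = 0 \/ k = 1 \/ k = -1 by nia.
case=> [k0|[k1|k1]].
- move: e1 e2; rewrite k0 !mul0r => e1 e2.
  have [e|e] := normals_parallel HV vV zV e1.
    by move: vw0; rewrite e detC e2 oppr0 eqxx.
  by move: vw0; rewrite e detNl detC e2 !oppr0 eqxx.
- move: e1 e2; rewrite k1 !mul1r => e1 e2.
  by exists z; split=> // y yV; rewrite ?e1 ?e2; [apply: umax|apply: u'max].
- move: e1 e2; rewrite k1 !mulN1r => e1 e2.
  exists (- z); split=> // y yV; rewrite detNr ?e1 ?e2 opprK; [exact: umax|exact: u'max].
Qed.

(** At a crossing [p] of two lines only, the neighbours of [p] on one line and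
    on the other are joined by a side: a line separating them would have to pass
    through [p]. Here [p] is the first vertex on the ray of [v], one neighbour is
    the first vertex on the ray of [w] and the other is the second vertex on the
    ray of [v], which therefore lies on the line of a support of [w]. *)
Lemma second_support V v w u0 : simplicial_normals V -> v \in V -> w \in V ->
  adjacent V v w \/ adjacent V w v -> supports V v u0 -> simple_dir V v ->
  exists z, [/\ supports V w z, z != u0 &
    forall y, y \in V -> y != u0 -> det v y <= det v z].
Proof.
move=> HV vV wV adj su simple.
have vw0 : det v w != 0.
  by case: adj => /det_neq0_of_adjacent //; rewrite detC oppr_eq0.
have wv0 : det w v != 0 by rewrite detC oppr_eq0.
have [u /simple /(_ su) -> su'] := common_support HV vV wV adj.
have m0 := support_gt0 HV wV vw0 su; have mw0 := support_gt0 HV vV wv0 su'.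
have [uV umax] := su; have [_ umaxw] := su'.
have : v \in [seq y <- V | y != u0].
  by rewrite mem_filter vV andbT; apply/eqP => e; move: m0; rewrite -e detxx.
move/(max_exists (det v)) => [z2]; rewrite mem_filter => /andP[z2u z2V] z2max.
have second y : y \in V -> y != u0 -> det v y <= det v z2.
  by move=> yV yu; apply: z2max; rewrite mem_filter yu.
have lt_m : det v z2 < det v u0.
  rewrite lt_neqAle umax // andbT; apply/eqP => e.
  by move/eqP: z2u; apply; apply: simple => //; split=> // y yV; rewrite e umax.
have m20 : 0 < det v z2.
  have wu : w != u0 by apply/eqP => e; move: mw0; rewrite -e detxx.
  have wNu : - w != u0 by apply/eqP => e; move: mw0; rewrite -e detNr detxx.
  have := second _ wV wu; have := second _ (normals_opp HV wV) wNu.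
  by rewrite detNr; lia.
(* The second vertex is [v / m2] or [2 v / m], whichever comes first, where [m]
   and [m2] are the largest and second largest values of [det v]. *)
have [c [r [c0 r0 Rv [cm2 cm cmr]]]] : exists c r : int, [/\ 0 < c, 0 < r,
    is_vertex V (v *~ c, r) & [/\ c * det v z2 <= r, c * det v u0 <= 2 * r &
    c * det v u0 != r]].
  have [le|lt] := leP (det v u0) (2 * det v z2).
    exists 1, (det v z2); split=> //; last by split; lia.
    exists v, 0, z2, 1; split=> //; first lia;
      by rewrite /on_line /= detZl ?detxx; lia.
  exists 2, (det v u0); split=> //; last by split; lia.
  exists v, 0, u0, 2; split=> //; first lia;
    by rewrite /on_line /= detZl ?detxx; lia.
have [|z [k [zV]]] := normals_triangular HV (P := (w, det w u0))
    (Q := (v *~ c, r)) mw0 r0 _ Rv.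
  exists w, 0, u0, 1; split=> //; first lia;
    by rewrite /on_line /= ?detxx; lia.
rewrite /on_line /strictly_below /strictly_above /= detZl.
have h1 := umaxw _ zV; have := umaxw _ (normals_opp HV zV).
rewrite detNr => h2; have h3 := umax _ zV.
case=> [[e1 e2]|[e1 e2]]; last first.
  have k0 : 0 <= k by nia.
  have k1 : k <= 1 by nia.
  have {k0 k1} [k0|k1] : k = 0 \/ k = 1 by lia.
    have adj' : adjacent V w v \/ adjacent V v w by case: adj; [right|left].
    move: e1 e2; rewrite k0 !mul0r => e1 e2.
    by case: (adjacent_noseparate HV adj' zV e1); nia.
  move: e1 e2; rewrite k1 !mul1r => e1 e2.
  have [zu|zu] := eqVneq z u0; first by move: e1; rewrite zu ltxx.
  by have := second _ zV zu; nia.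
have hk : k = 0 \/ k = 1 \/ k = -1 by nia.
have {hk} [z' [z'V e1' e2']] : exists z',
    [/\ z' \in V, det w z' = det w u0 & c * det v z' = r].
  case: hk => [k0|[k1|k1]].
  - move: e1 e2; rewrite k0 !mul0r => e1 e2.
    have vz : det v z = 0 by nia.
    have [e|e] := normals_parallel HV wV zV e1; move: vw0 vz; rewrite e.
      by move=> /eqP.
    by rewrite detNr => /eqP h1' h2'; case: h1'; rewrite h2' oppr0.
  - by exists z; split=> //; lia.
  - exists (- z); rewrite !detNr; split; [exact: (normals_opp HV)|lia|lia].
have z'u : z' != u0 by apply/eqP => e; move: cmr; rewrite -e2' e eqxx.
exists z'; split=> //; first by split=> // y yV; rewrite e1' umaxw.
by move=> y yV yu; apply: le_trans (second _ yV yu) _; nia.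
Qed.

(** Two crossings of two lines only are never neighbours: the side provided by
    [second_support] would be on a third line through one of them. *)
Lemma simple_not_adjacent V v w : simplicial_normals V -> v \in V -> w \in V ->
  adjacent V v w \/ adjacent V w v -> simple_dir V v -> ~ simple_dir V w.
Proof.
move=> HV vV wV adj simple simplew.
have [u su suw] := common_support HV vV wV adj.
have [z [/simplew/(_ suw) -> ]] := second_support HV vV wV adj su simple.
by rewrite eqxx.
Qed.

(** The second vertex on the ray of a simple direction [v] is joined to the
    first vertices on both neighbouring rays, by lines whose normals are at the
    same height over [v]. As [v] is primitive, their difference is an integer
    multiple of [v]. This integrality is what bounds the number of directions:
    around a point, the axes and the sides of any regular polygon form triangular
    cells too. *)
Lemma simple_chord V v w w' u0 : simplicial_normals V ->
  v \in V -> w \in V -> w' \in V -> adjacent V w v -> adjacent V v w' ->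
  supports V v u0 -> simple_dir V v ->
  exists c c' s, [/\ supports V w c, supports V w' c', c - c' = v *~ s, 0 < s &
    forall y, y \in V -> y != u0 -> det v y <= det v c] /\ det v c = det v c'.
Proof.
move=> HV vV wV w'V adj adj' su simple.
have [c [sc cu cmax]] := second_support HV vV wV (or_intror adj) su simple.
have [c' [sc' c'u c'max]] := second_support HV vV w'V (or_introl adj') su simple.
have [[cV cw] [c'V c'w]] := (sc, sc').
have ecc : det v c = det v c' by apply/le_anti; rewrite cmax // c'max.
have [s es] : exists s, c - c' = v *~ s.
  by apply: (normals_primitive HV vV); rewrite !detE ecc subrr.
have [u1 /simple/(_ su) -> suw] := common_support HV vV wV (or_intror adj).
have [u2 /simple/(_ su) -> suw'] := common_support HV vV w'V (or_introl adj').
have [[wv _] [vw' _]] := (adj, adj').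
have sge0 : 0 <= s.
  have : 0 <= det w' (c' - c) by rewrite !detE subr_ge0 c'w.
  rewrite -opprB es detNr detZr (detC w'); nia.
exists c, c', s; split=> //; split=> //; rewrite lt_neqAle sge0 andbT.
apply/eqP => s0; move: es; rewrite -s0 mulr0z => /eqP; rewrite subr_eq0 => /eqP ec.
have ew : det w (c - u0) = 0.
  by rewrite !detE; apply/eqP; rewrite subr_eq0 eq_le suw.2 ?sc.2 ?suw.1 ?cV.
have ew' : det w' (c - u0) = 0.
  by rewrite !detE ec; apply/eqP; rewrite subr_eq0 eq_le suw'.2 ?sc'.2 ?suw'.1 ?c'V.
have vlt : det v (c - u0) != 0.
  rewrite !detE subr_eq0; apply/eqP => e; move/eqP: cu; apply; apply: simple => //.
  by split=> // y yV; rewrite e su.2.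
have ww' : det w' w = 0.
  have : det w' w * det v (c - u0) = 0.
    have -> : det w' w * det v (c - u0) =
        - (det w v * det w' (c - u0) + det v w' * det w (c - u0))
      by rewrite /det /=; ring.
    by rewrite ew ew' !mulr0 addr0 oppr0.
  by move/eqP; rewrite mulf_eq0 (negbTE vlt) orbF => /eqP.
have [e|e] := normals_parallel HV w'V wV ww'.
  by move: vw'; rewrite e detC; lia.
have g0 : 0 < det w u0 by apply: (support_gt0 HV vV _ suw); lia.
have : 0 < det w' u0.
  by apply: (support_gt0 HV vV _ suw'); rewrite detC; lia.
by rewrite e detNl; lia.
Qed.

(** The Plücker relation again, with the signs that suit four vectors met in the
    order [x], [u], [v], [w]. *)
Lemma three_term x u v w :
  det x v * det u w = det x u * det v w + det x w * det u v.
Proof. rewrite /det; ring. Qed.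

Lemma det_between x u v w : 0 < det x u -> 0 < det x v -> 0 < det x w ->
  0 < det u v -> 0 <= det v w -> 0 < det u w.
Proof. by move=> h1 h2 h3 h4 h5; have := three_term x u v w; nia. Qed.

(** * Reflection *)

(** Exchanging the coordinates changes the sign of the determinant, hence
    reverses the order of the directions and the sign of supports. It carries
    statements about the beginning of a sector to statements about its end. *)
Definition flip (x : vec) : vec := (x.2, x.1).

Lemma flipK : involutive flip. Proof. by case. Qed.

Lemma flipN x : flip (- x) = - flip x. Proof. by []. Qed.

Lemma det_flip x y : det (flip x) (flip y) = - det x y.
Proof. rewrite /det /=; ring. Qed.

Lemma det_flipl x y : det (flip x) y = - det x (flip y).
Proof. rewrite /det /=; ring. Qed.

Lemma mem_flip V x : (x \in map flip V) = (flip x \in V).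
Proof. by rewrite -{1}[x]flipK mem_map //; apply: can_inj flipK. Qed.

Lemma support_flip V v u : simplicial_normals V ->
  supports (map flip V) v u <-> supports V (flip v) (- flip u).
Proof.
move=> HV; split=> -[uV umax]; split.
- by apply: (normals_opp HV); rewrite -mem_flip.
- move=> z zV; have := umax (- flip z).
  rewrite mem_flip flipN flipK.
  by move=> /(_ (normals_opp HV zV)); rewrite !detNr !det_flipl flipK opprK.
- by move: (normals_opp HV uV); rewrite opprK mem_flip.
- move=> z; rewrite mem_flip => zV; have := umax _ (normals_opp HV zV).
  by rewrite !detNr !det_flip !opprK.
Qed.

Lemma adjacent_flip V v w :
  adjacent (map flip V) v w <-> adjacent V (flip w) (flip v).
Proof.
rewrite /adjacent det_flip -detC; split=> -[vw h]; split=> // z zV h1.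
  rewrite leNgt; apply/negP => h2.
  rewrite det_flipl in h1; rewrite detC det_flipl opprK in h2.
  have := h (flip z); rewrite mem_flip flipK => /(_ zV h2).
  by rewrite detC; lia.
rewrite leNgt; apply/negP => h2; move: zV; rewrite mem_flip => /h.
by rewrite !det_flip (detC w) (detC z v); lia.
Qed.

Lemma simple_dir_flip V v : simplicial_normals V ->
  simple_dir V v -> simple_dir (map flip V) (flip v).
Proof.
move=> HV sv u u' /(support_flip _ _ HV) + /(support_flip _ _ HV).
rewrite flipK => /sv h /h /oppr_inj; exact: (can_inj flipK).
Qed.

Lemma flip_normals V : simplicial_normals V -> simplicial_normals (map flip V).
Proof.
move=> HV; split.
- by move=> x; rewrite !mem_flip; apply: (normals_opp HV).
- move=> x y; rewrite !mem_flip => xV yV xy.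
  have [|e|e] := normals_parallel HV xV yV; first by rewrite det_flip xy oppr0.
    by left; apply: (can_inj flipK).
  by right; apply: (can_inj flipK); rewrite e.
- move=> x y; rewrite mem_flip => xV xy.
  have [|s e] := normals_primitive HV (y := flip y) xV.
    by rewrite det_flip xy oppr0.
  exists s; apply: (can_inj flipK); rewrite e.
  rewrite [LHS]surjective_pairing /flip.
  by rewrite !(raddfMz fst) !(raddfMz snd).
- have vertex_flip P : is_vertex (map flip V) P -> is_vertex V (flip P.1, P.2).
    case=> u [k [u' [k' [uV u'V uu' h h']]]].
    exists (- flip u), k, (- flip u'), k'; split.
    + by apply: (normals_opp HV); rewrite -mem_flip.
    + by apply: (normals_opp HV); rewrite -mem_flip.
    + by rewrite detNl detNr opprK det_flip oppr_eq0.
    + by rewrite /on_line detNr det_flip opprK.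
    + by rewrite /on_line detNr det_flip opprK.
  move=> P Q P0 Q0 /vertex_flip VP /vertex_flip VQ.
  have [u [k [uV h]]] := normals_triangular HV (P := (_, _)) (Q := (_, _)) P0 Q0 VP VQ.
  exists (- flip u), k; split.
    by rewrite mem_flip flipN flipK; apply: (normals_opp HV).
  move: h; rewrite /on_line /strictly_above /strictly_below /=.
  by rewrite !det_flipl !detNr.
Qed.

(** * Neighbouring directions *)
Lemma least_exists (T : eqType) (e : rel T) (s : seq T) x0 :
  {in s &, forall x y, e x y || e y x} ->
  {in s & &, forall y x z, e x y -> e y z -> e x z} -> x0 \in s ->
  exists2 m, m \in s & forall z, z \in s -> e m z.
Proof.
elim: s x0 => [//|x s IH] x0 tot tr _.
have exx : e x x by have := tot x x (mem_head _ _) (mem_head _ _); rewrite orbb.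
case: s IH tot tr => [|y s] IH tot tr.
  by exists x => [|z]; rewrite !inE // => /eqP->.
have [|||m ms mmin] := IH y.
- by move=> u v us vs; apply: tot; rewrite inE ?us ?vs orbT.
- by move=> u v w us vs ws; apply: tr; rewrite inE ?us ?vs ?ws orbT.
- exact: mem_head.
have ms' : m \in x :: y :: s by rewrite inE ms orbT.
have [em|em] := boolP (e m x).
  by exists m => // z; rewrite inE => /orP[/eqP->|/mmin].
have exm : e x m by have := tot x m (mem_head _ _) ms'; rewrite (negbTE em) orbF.
exists x; first exact: mem_head.
move=> z; rewrite inE => /orP[/eqP->//|zs]; apply: (tr m) (mmin _ zs) => //.
  exact: mem_head.
by rewrite inE zs orbT.
Qed.

Lemma next_dir V x y : simplicial_normals V -> x \in V -> y \in V ->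
  0 < det x y -> exists x', [/\ x' \in V, adjacent V x x' & x' = y \/ 0 < det x' y].
Proof.
move=> HV xV yV xy.
pose S := [seq z <- V | (0 < det x z) && (0 <= det z y)].
have yS : y \in S by rewrite mem_filter xy yV detxx lexx.
have [||x'] := least_exists (e := fun z z' => 0 <= det z z') (s := S) _ _ yS.
- by move=> z z' _ _; rewrite (detC z' z) oppr_ge0; apply: le_total.
- move=> z2 z1 z3; rewrite !mem_filter => /andP[/andP[h2 _] _].
  move=> /andP[/andP[h1 _] _] /andP[/andP[h3 _] _] h12 h23.
  by have := three_term x z1 z2 z3; nia.
rewrite mem_filter => /andP[/andP[xx' x'y] x'V] x'min.
exists x'; split=> //.
  split=> // z zV xz; rewrite leNgt; apply/negP => zx'.
  have : z \in S by rewrite mem_filter xz zV andbT ltW // (@det_between x z x' y).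
  by move=> /x'min; rewrite detC; lia.
move: x'y; rewrite le_eqVlt => /orP[/eqP/esym e|]; last by right.
have [->|e'] := normals_parallel HV x'V yV e; first by left.
by move: xx'; rewrite e' detNr; lia.
Qed.

Lemma prev_dir V x y : simplicial_normals V -> x \in V -> y \in V ->
  0 < det x y -> exists y', [/\ y' \in V, adjacent V y' y & y' = x \/ 0 < det x y'].
Proof.
move=> HV xV yV xy.
have [|||y' [y'V adj h]] := next_dir (flip_normals HV) (x := flip y) (y := flip x).
- by rewrite mem_flip flipK.
- by rewrite mem_flip flipK.
- by rewrite det_flip detC opprK.
exists (flip y'); split; first by rewrite -mem_flip.
  by move: adj; rewrite adjacent_flip flipK.
case: h => [->|]; first by left; rewrite flipK.
by rewrite -{1}(flipK y') det_flip -detC; right.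
Qed.

Lemma adjacent_next V x x' z : simplicial_normals V -> x' \in V -> z \in V ->
  adjacent V x x' -> 0 < det x z -> z = x' \/ 0 < det x' z.
Proof.
move=> HV x'V zV [xx' h] xz; have := h _ zV xz; rewrite le_eqVlt => /orP[/eqP e|].
  have [->|e'] := normals_parallel HV zV x'V e; first by left.
  by move: xz; rewrite e' detNr; lia.
by rewrite (detC z) oppr_lt0; right.
Qed.

Lemma adjacent_prev V y' y z : simplicial_normals V -> y' \in V -> z \in V ->
  adjacent V y' y -> 0 < det z y -> z = y' \/ 0 < det z y'.
Proof.
move=> HV y'V zV [y'y h] zy.
have : 0 <= det z y' by rewrite leNgt (detC z) oppr_lt0; apply/negP => /(h _ zV); lia.
rewrite le_eqVlt => /orP[/eqP/esym e|]; last by right.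
have [->|e'] := normals_parallel HV zV y'V e; first by left.
by move: zy; rewrite e' detNl; lia.
Qed.

Lemma det_cases V x z : simplicial_normals V -> x \in V -> z \in V ->
  [\/ z = x, z = - x, 0 < det x z | 0 < det z x].
Proof.
move=> HV xV zV; have [h|h|/esym/eqP e] := ltgtP 0 (det z x).
- by constructor 4.
- by constructor 3; rewrite detC; lia.
- move/eqP: e => e; have [->|->] := normals_parallel HV zV xV e.
    by constructor 1.
  by constructor 2.
Qed.

(** * When the maximal determinant is reached twice *)

(** The vector [b] is the only support of every direction between [a] and
    [a + b]. So these directions are simple, and two of them would be
    neighbours. *)
Lemma hexagon_sector V a b : simplicial_normals V -> a \in V -> b \in V ->
  a + b \in V -> 0 < det a b ->
  (forall x y, x \in V -> y \in V -> det x y <= det a b) ->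
  exists z0, forall z, z \in V -> 0 < det a z -> 0 < det z (a + b) -> z = z0.
Proof.
move=> HV aV bV abV M0 Mmax.
have simple z : 0 < det a z -> 0 < det z (a + b) -> simple_dir V z.
  move=> az; rewrite detDr (detC z a) => zab.
  suff supp u : supports V z u -> u = b by move=> u u' /supp-> /supp->.
  case=> uV /(_ _ bV) zu; have := Mmax _ _ aV uV; have := Mmax _ _ abV uV.
  rewrite detDl => h1 h2; have := plucker a b z u; rewrite (detC u b) => h3.
  have h4 : det a u = det a b /\ det b u = 0 by split; nia.
  by apply: (@det_inj a b); [lia|case: h4|rewrite detxx detC h4.2 oppr0].
have aab : 0 < det a (a + b) by rewrite !detE add0r.
have [w [wV adj [e|wab]]] := next_dir HV aV abV aab.
  by exists a => z zV az zab; case: adj => _ /(_ z zV az); rewrite e; lia.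
have sw : simple_dir V w by apply: simple wab; case: adj.
have [w' [w'V adj' [e|w'ab]]] := next_dir HV wV abV wab.
  exists w => z zV az zab.
  have [//|wz] := adjacent_next HV wV zV adj az.
  by case: adj' => _ /(_ z zV wz); rewrite e; lia.
have aw' : 0 < det a w'.
  case: adj adj' => aw _ [ww' _].
  by have := three_term a w w' (a + b); nia.
have sw' := simple _ aw' w'ab.
by case: (simple_not_adjacent HV wV w'V (or_introl adj') sw).
Qed.

(** A second vector [b2] where [det a] reaches its maximum differs from [b] by a
    multiple of [a]; the maximality of [det a b] bounds [det b b2] and leaves only
    [b + a] and [b - a]. *)
Lemma hexagon_case V a b b2 : simplicial_normals V -> a \in V -> b \in V ->
  0 < det a b -> (forall x y, x \in V -> y \in V -> det x y <= det a b) ->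
  supports V a b2 -> b2 != b ->
  exists2 L : seq vec, (size L <= 6)%N & forall z, z \in V -> z \in L \/ - z \in L.
Proof.
move=> HV aV bV M0 Mmax [b2V b2max] b2b.
have ab2 : det a b2 = det a b by apply/le_anti; rewrite Mmax // b2max.
have [c [cV acV Mc]] : exists c, [/\ c \in V, a + c \in V & det a c = det a b].
  have [|s es] := normals_primitive HV (y := b2 - b) aV.
    by rewrite !detE ab2 subrr.
  have eb2 : b2 = b + a *~ s by rewrite -es addrC subrK.
  have : det b b2 = - (s * det a b) by rewrite eb2 !detE add0r (detC b a) mulrN.
  have := Mmax _ _ bV b2V; have := Mmax _ _ b2V bV; rewrite (detC b2) => h1 h2 h3.
  have hs : s = 1 \/ s = -1.
    have : s != 0 by apply/eqP => s0; move: b2b; rewrite eb2 s0 mulr0z addr0 eqxx.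
    nia.
  case: hs => e; move: eb2; rewrite e ?mulrNz mulr1z => eb2.
    by exists b; split=> //; rewrite addrC -eb2.
  by exists b2; split=> //; rewrite eb2 addrC subrK.
rewrite -Mc in M0 Mmax; move: (normals_opp HV) => opp.
have [z1 h1] := hexagon_sector HV aV cV acV M0 Mmax.
have e2 : (a + c) + (- a) = c by rewrite addrC addKr.
have d2 : det (a + c) (- a) = det a c by rewrite !detE (detC c); lia.
have [|||z2 h2] := hexagon_sector HV acV (opp _ aV).
- by rewrite e2.
- by rewrite d2.
- by move=> x y; rewrite d2; apply: Mmax.
have e3 : c + (- (a + c)) = - a by rewrite opprD addrCA subrr addr0.
have d3 : det c (- (a + c)) = det a c by rewrite !detE (detC c); lia.
have [|||z3 h3] := hexagon_sector HV cV (opp _ acV).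
- by rewrite e3; apply: opp.
- by rewrite d3.
- by move=> x y; rewrite d3; apply: Mmax.
rewrite e2 in h2; rewrite e3 in h3.
pose L := [:: a; c; a + c; z1; z2; z3].
have up z : z \in V -> 0 < det a z -> z \in L \/ - z \in L.
  move=> zV az; rewrite !inE.
  have [->|->|acz|zac] := det_cases HV acV zV.
  - by left; rewrite eqxx !orbT.
  - by right; rewrite opprK eqxx !orbT.
  - have [->|->|cz|zc] := det_cases HV cV zV.
    + by left; rewrite eqxx !orbT.
    + by right; rewrite opprK eqxx !orbT.
    + left; rewrite (h3 z) ?eqxx ?orbT //.
      by rewrite detNr (detC z) opprK.
    + by left; rewrite (h2 z) ?eqxx ?orbT.
  - by left; rewrite (h1 z) ?eqxx ?orbT.
exists L => // z zV; have [->|->|az|za] := det_cases HV aV zV.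
- by left; rewrite inE eqxx.
- by right; rewrite opprK inE eqxx.
- exact: up.
- have := up _ (opp _ zV); rewrite detNr (detC a) opprK => /(_ za).
  by rewrite opprK; case; [right|left].
Qed.

(** * When both extremal directions are simple *)
Record extremal_pair (V : seq vec) (a b : vec) : Prop := ExtremalPair {
  extremal_normals : simplicial_normals V;
  extremal_l : a \in V;
  extremal_r : b \in V;
  extremal_gt0 : 0 < det a b;
  extremal_max : forall x y, x \in V -> y \in V -> det x y <= det a b;
  extremal_simple_l : simple_dir V a;
  extremal_simple_r : simple_dir V b }.

Lemma simple_dirN V v : simplicial_normals V -> simple_dir V v -> simple_dir V (- v).
Proof.
move=> HV sv u u' [uV umax] [u'V u'max]; apply: oppr_inj; apply: sv; split.
- exact: (normals_opp HV).
- by move=> z zV; have := umax _ (normals_opp HV zV); rewrite !detE; lia.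
- exact: (normals_opp HV).
- by move=> z zV; have := u'max _ (normals_opp HV zV); rewrite !detE; lia.
Qed.

Lemma extremal_flip V a b :
  extremal_pair V a b -> extremal_pair (map flip V) (flip b) (flip a).
Proof.
case=> HV aV bV M0 Mmax sa sb; have eM : det (flip b) (flip a) = det a b.
  by rewrite det_flip -detC.
split; rewrite ?mem_flip ?flipK ?eM //.
- exact: flip_normals.
- move=> x y; rewrite !mem_flip => xV yV.
  by have := Mmax _ _ yV xV; rewrite det_flip -detC.
- exact: simple_dir_flip.
- exact: simple_dir_flip.
Qed.

Lemma extremal_rot V a b : extremal_pair V a b -> extremal_pair V b (- a).
Proof.
case=> HV aV bV M0 Mmax sa sb; have eM : det b (- a) = det a b.
  by rewrite detNr -detC.
by split; rewrite ?eM //; [apply: (normals_opp HV)|apply: simple_dirN].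
Qed.

Lemma extremal_support_l V a b : extremal_pair V a b -> supports V a b.
Proof. by case=> HV aV bV M0 Mmax sa sb; split=> // z; apply: Mmax. Qed.

Lemma extremal_support_r V a b : extremal_pair V a b -> supports V b (- a).
Proof. by move/extremal_rot/extremal_support_l. Qed.

Lemma extremal_lt V a b u : extremal_pair V a b -> u \in V -> u != b ->
  det a u < det a b.
Proof.
move=> E uV ub; rewrite lt_neqAle (extremal_max E) ?(extremal_l E) // andbT.
apply/eqP => e; move/eqP: ub; apply; apply: (extremal_simple_l E).
  by split=> // z zV; rewrite e; apply: (extremal_max E) => //; apply: extremal_l E.
exact: extremal_support_l.
Qed.

Definition inside a b z := 0 < det a z /\ 0 < det z b.

(** In the basis [a], [b], [V] is contained in the square with coordinates
    bounded by 1, so a vector outside of the closed sector from [b] to [- a] is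
    lower than [b] or [- a] in every direction between [a] and [b]. *)
Lemma support_inside V a b z u : extremal_pair V a b -> inside a b z ->
  supports V z u -> 0 <= det a u /\ 0 <= det b u.
Proof.
move=> E [az zb] [uV umax]; have M0 := extremal_gt0 E.
have h1 := umax _ (extremal_r E).
have h2 := umax _ (normals_opp (extremal_normals E) (extremal_l E)).
have h3 := extremal_max E (extremal_l E) uV.
have h4 := extremal_max E (extremal_r E) uV.
have := plucker a b z u; rewrite (detC u b) mulrN opprK => h5.
rewrite detNr (detC z a) opprK in h2.
by split; nia.
Qed.

(** What [simple_chord] gives at [a]: [x] is the first direction after [a], the
    chord of direction [a] joins [g] to [g + a], and no vector of [V] other than
    [b] is higher over [a] than these two. *)
Record first_chord (V : seq vec) (a b x g : vec) : Prop := FirstChord {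
  chord_dir : x \in V;
  chord_adj : adjacent V a x;
  chord_inside : inside a b x;
  chord_support_r : supports V x b;
  chord_support : supports V x g;
  chord_neq : g != b;
  chord_shift : g + a \in V;
  chord_gt0 : 0 < det a g;
  chord_second : forall y, y \in V -> y != b -> det a y <= det a g }.

Lemma chord_in V a b x g : first_chord V a b x g -> g \in V.
Proof. by move/chord_support => []. Qed.

(** The multiple of [a] that [simple_chord] provides is [a] itself, because
    [det b] stays between [- det a b] and [det a b] and takes the latter value
    only at [- a], so that it varies by less than [2 * det a b] along the
    chord. *)
Lemma first_chord_exists V a b : extremal_pair V a b ->
  exists x g, first_chord V a b x g.
Proof.
move=> E; have [HV aV bV M0 Mmax sa sb] := E.
have [x [xV adj hx]] := next_dir HV aV bV M0.
have xb : 0 < det x b.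
  case: hx => // e; case: (simple_not_adjacent HV aV xV (or_introl adj) sa).
  by rewrite e.
have [|w [wV adjw _]] := prev_dir HV (normals_opp HV bV) aV.
  by rewrite detNl -detC.
have supp := extremal_support_l E.
have [c [g [s [[sc sg e s0 second] ecg]]]] :=
  simple_chord HV aV wV xV adjw adj supp sa.
have gV : g \in V by case: sg.
have cV : c \in V by case: sc.
have xneb : x != b by apply/eqP => e'; move: xb; rewrite e' detxx.
have ax : 0 < det a x by case: adj.
have ag : 0 < det a g by rewrite -ecg; apply: lt_le_trans ax (second _ xV xneb).
have gb : g != b.
  apply/eqP => egb; have [ecb|/(extremal_lt E cV)] := eqVneq c b.
    have := congr1 (det^~ b) e; rewrite ecb egb subrr detZl /det /= !mul0r.
    by rewrite -/(det a b) => /esym /eqP; rewrite mulf_eq0; lia.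
  by rewrite ecg egb ltxx.
have [u /sa /(_ supp) -> sxb] := common_support HV aV xV (or_introl adj).
exists x, g; split=> //.
  suff <- : c = g + a by [].
  suff -> : a = a *~ s by rewrite -e addrC subrK.
  have : det b g < det a b.
    have := extremal_lt (extremal_rot E) gV; rewrite detNr -detC; apply.
    by apply/eqP => e'; move: ag; rewrite e' detNr detxx oppr0 ltxx.
  have := Mmax _ _ (normals_opp HV bV) cV; rewrite detNl.
  have := congr1 (det b) e; rewrite !detE (detC b a) => h1 h2 h3.
  have -> : s = 1 by nia.
  by rewrite mulr1z.
by move=> y yV yb; rewrite -ecg; apply: second.
Qed.

(** The mirror image of [first_chord]: [x] is the last direction before [b], and
    the chord of direction [b] joins [k] to [k - b]. *)
Definition last_chord V a b x k :=
  first_chord (map flip V) (flip b) (flip a) (flip x) (- flip k).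

Lemma last_chord_exists V a b : extremal_pair V a b ->
  exists x k, last_chord V a b x k.
Proof.
move/extremal_flip/first_chord_exists => [x [k h]].
by exists (flip x), (- flip k); rewrite /last_chord flipN opprK !flipK.
Qed.

Lemma last_chordP V a b x k : simplicial_normals V -> last_chord V a b x k ->
  [/\ x \in V, adjacent V x b, inside a b x, supports V x (- a) & supports V x k] /\
  [/\ k != - a, b - k \in V, 0 < det b k &
    forall y, y \in V -> y != - a -> det b y <= det b k].
Proof.
move=> HV [h1 h2 [h3 h3'] h4 h5 h6 h7 h8 h9]; split; split.
- by rewrite mem_flip flipK in h1.
- by rewrite adjacent_flip !flipK in h2.
- by move: h3 h3'; rewrite !det_flip -!detC.
- by move: h4; rewrite support_flip // !flipK.
- by move: h5; rewrite support_flip // flipN opprK !flipK.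
- apply/eqP => e; move: h6; rewrite e flipN opprK eqxx; done.
- by move: h7; rewrite addrC mem_flip -(flipK (_ - _)).
- by move: h8; rewrite detNr det_flip opprK.
- move=> y yV ya; have := h9 (- flip y); rewrite !detNr !det_flip !opprK; apply.
    by rewrite mem_flip flipN flipK; apply: (normals_opp HV).
  by apply/eqP => e; move/eqP: ya; apply; rewrite -(flipK a) -e flipN flipK opprK.
Qed.

(** Both [b] and [g] support [x], so [b - g] is a positive multiple of [x], and
    [g] is higher than [b] in every direction after [x]. *)
Lemma first_chord_beats V a b x g z : extremal_pair V a b ->
  first_chord V a b x g -> 0 < det x z -> det z b < det z g.
Proof.
move=> E C xz; have HV := extremal_normals E.
have [_ bmax] := chord_support_r C; have [gV gmax] := chord_support C.
have exb : det x b = det x g by apply/le_anti; rewrite bmax // gmax // (extremal_r E).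
have [|s es] := normals_primitive HV (y := b - g) (chord_dir C).
  by rewrite !detE exb subrr.
have := congr1 (det a) es; have := congr1 (det z) es; rewrite !detE (detC z x).
have := extremal_lt E gV (chord_neq C); have [ax _] := chord_inside C.
by nia.
Qed.

Lemma last_chord_beats V a b x k z : extremal_pair V a b ->
  last_chord V a b x k -> 0 < det z x -> det z (- a) < det z k.
Proof.
move=> E C zx; have := @first_chord_beats _ _ _ _ _ (flip z) (extremal_flip E) C.
by rewrite det_flip -detC => /(_ zx); rewrite detNr !det_flip opprK detNr.
Qed.

Lemma inside_between a b x y z : inside a b x -> inside a b y ->
  0 < det x y -> 0 < det x z -> 0 < det z y -> inside a b z.
Proof.
move=> [ax xb] [ay yb] xy xz zy.
have h1 := three_term a x z y; have h2 := three_term x z y b.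
by split; nia.
Qed.

(** The second direction of the sector is [h = b - k]. Two vectors of the
    next sector at the same height over [h], neither of which is [- a], can only
    be [k] and [b], and [- a] is lower over [h] than [b]. If [h] had two
    supports, [b] would be one of them, which forces [h = x1] and then [k = g].
    So [h] is simple and its chord joins [k] to [b]. The direction before [h] is
    therefore supported by [b], so it is [x1]; and [h] is supported by [g], which
    is higher than [b]. *)
Lemma inner_gap V a b x1 g x2 k : extremal_pair V a b ->
  first_chord V a b x1 g -> last_chord V a b x2 k -> 0 < det x1 x2 -> k != g ->
  exists w, [/\ w \in V, adjacent V x1 (b - k), adjacent V (b - k) w,
    inside a b w & supports V w g /\ supports V w k].
Proof.
move=> E C D x12 kg; have [HV aV bV M0 Mmax sa sb] := E.
have [[x2V adj2 in2 s2a s2k] [ka hV bk0 k_second]] := last_chordP HV D.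
have [x1V adj1 in1 s1b s1g] := And5 (chord_dir C) (chord_adj C) (chord_inside C)
  (chord_support_r C) (chord_support C).
have kV : k \in V by case: s2k.
have [ak0 _] := support_inside E in2 s2k.
have kb : k != b by apply/eqP => e; move: bk0; rewrite e detxx.
have akM := extremal_lt E kV kb.
have bkM : det b k < det a b.
  have := extremal_lt (extremal_rot E) kV ka; by rewrite detNr -detC.
have [h eh] : exists h, h = b - k by exists (b - k).
rewrite -eh in hV *.
have ah : det a h = det a b - det a k by rewrite eh !detE.
have hb : det h b = det b k by rewrite eh !detE sub0r -detC.
have bh : det b h = - det b k by rewrite eh !detE sub0r.
have inh : inside a b h by split; rewrite ?hb // ah subr_gt0.
(* This is the inequality [det a b < det a k + det b k]: as [k + a] is a positive
   multiple of [x2], it says that [b] is lower than [- a] in direction [x2]. *)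
have h_ab : det h (- a) < det h b.
  have := first_chord_beats E C x12.
  have [_ max2] := s2a; have := max2 _ (chord_in C) => h1 h2.
  have [|t et] := normals_primitive HV (y := k + a) x2V.
    have e : det x2 k = det x2 (- a).
      by apply/le_anti; rewrite s2a.2 // s2k.2 //; case: s2a.
    by rewrite detDr e detNr addNr.
  have h3 : det a k = t * det a x2 by rewrite -detZr -et !detE addr0.
  have h4 : det a b - det b k = t * det x2 b.
    by rewrite -detZl -et !detE (detC k b) addrC.
  have [ax2 x2b] := in2; have t0 : 0 < t by clear -h4 x2b bkM; nia.
  have h5 : det x2 (- a) = det a x2 by rewrite detNr -detC.
  have h6 : det h (- a) = det a h by rewrite detNr -detC.
  rewrite h6 hb ah; rewrite h5 in h1; clear -h1 h2 h3 h4 t0; nia.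
have x1_top z : 0 < det x1 z -> ~ supports V z b.
  by move=> /(first_chord_beats E C) lt [_ /(_ _ (chord_in C))]; rewrite leNgt lt.
have x1_nsimple : ~ simple_dir V x1.
  exact: (simple_not_adjacent HV aV x1V (or_introl adj1) sa).
have x2_nsimple : ~ simple_dir V x2.
  exact: (simple_not_adjacent HV bV x2V (or_intror adj2) sb).
(* As [k] is the second highest vector over [b], no chord of direction [h] other
   than the one from [k] to [b] fits between heights 0 and [det b k]. *)
have chord_h A B s : A \in V -> B \in V -> 0 <= det b B -> 0 <= det a B ->
    A != - a -> B - A = h *~ s -> 0 < s -> B = b /\ A = k.
  move=> AV BV bB aB Aa es s0; have := congr1 (det b) es.
  rewrite !detE bh => h1; have h2 := k_second _ AV Aa.
  have s1 : s = 1 by clear -h1 h2 bB s0 bk0; nia.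
  have bB0 : det b B = 0 by clear -h1 h2 bB s1 bk0; nia.
  have eB : B = b.
    have [->//|e] := normals_parallel HV bV BV bB0.
    by move: aB M0; rewrite -[B]opprK -e detNr; clear; lia.
  split=> //; move: es; rewrite s1 mulr1z eB eh => /addrI/oppr_inj; exact.
have x1h : h = x1 \/ 0 < det x1 h.
  by apply: (adjacent_next HV x1V hV adj1); case: inh.
have h_simple : simple_dir V h.
  suff no A B s : supports V h A -> supports V h B -> B - A = h *~ s -> 0 < s -> False.
    move=> u u' su su'; have [uV umax] := su; have [u'V u'max] := su'.
    have euu : det h u = det h u' by apply/le_anti; rewrite umax // u'max.
    have [|s es] := normals_primitive HV (y := u - u') hV.
      by rewrite !detE euu subrr.
    have [s0|s0|s0] := ltgtP s 0.
    - case: (no u u' (- s) su su'); last by rewrite oppr_gt0.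
      by rewrite mulrNz -es opprB.
    - by case: (no u' u s su' su).
    - by move: es; rewrite s0 mulr0z => /eqP; rewrite subr_eq0 => /eqP.
  move=> sA sB es s0; have [bB aB] := support_inside E inh sB.
  have Aa : A != - a.
    by apply/eqP => e; have [_ /(_ _ bV)] := sA; rewrite e leNgt h_ab.
  have [eB eA] := chord_h A B s sA.1 sB.1 aB bB Aa es s0.
  rewrite eA in sA; rewrite eB in sB.
  case: x1h => [e|/x1_top/(_ sB)//].
  have [|s1 es1] := normals_primitive HV (y := b - g) hV.
    rewrite e !detE; apply/eqP; rewrite subr_eq0 eq_le s1g.2 // s1b.2 //.
    exact: chord_in C.
  have := congr1 (det b) es1; have := congr1 (det a) es1.
  rewrite !detE bh ah => h1 h2.
  have := extremal_lt E (chord_in C) (chord_neq C) => h3.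
  have ga : g != - a.
    by apply/eqP => e'; have := chord_gt0 C; rewrite e' detNr detxx ltxx.
  have h4 := k_second _ (chord_in C) ga.
  have s10 : 0 < s1 by clear -h1 h3 akM; nia.
  have s11 : s1 = 1 by clear -h2 h4 s10 bk0; nia.
  move: es1; rewrite s11 mulr1z eh => /addrI/oppr_inj e'.
  by move: kg; rewrite e' eqxx.
have {x1h} x1h : 0 < det x1 h by case: x1h => // e; case: x1_nsimple; rewrite -e.
have hx2 : 0 < det h x2.
  have [||//] := adjacent_prev HV x2V hV adj2; first by case: inh.
  by move=> e; case: x2_nsimple; rewrite -e.
have [w [wV adjw hw]] := prev_dir HV x1V hV x1h.
have [w' [w'V adjw' hw']] := next_dir HV hV x2V hx2.
have inw : inside a b w.
  case: hw => [->//|x1w]; apply: (inside_between in1 inh) => //; by case: adjw.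
have inw' : inside a b w'.
  case: hw' => [->//|w'x2]; apply: (inside_between inh in2) => //; by case: adjw'.
have [u0 su0] := support_exists h hV.
have [c [c' [s [[sc sc' es s0 second] ecc]]]] :=
  simple_chord HV hV wV w'V adjw adjw' su0 h_simple.
have [ac bc] := support_inside E inw sc.
have bu0 : b != u0 by apply/eqP => e; case: (x1_top _ x1h); rewrite e.
have c'a : c' != - a.
  by apply/eqP => e; have := second _ bV bu0; rewrite ecc e leNgt h_ab.
have [ecb ec'k] := chord_h c' c s sc'.1 sc.1 bc ac c'a es s0.
rewrite ecb in sc second; rewrite ec'k in sc'.
have ew : w = x1 by case: hw => // /x1_top/(_ sc).
have gu0 : g = u0.
  apply/eqP/negP => /negP /(second _ (chord_in C)).
  by rewrite leNgt (first_chord_beats E C x1h).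
exists w'; split=> //; first by rewrite -ew.
split=> //; have [u su suw'] := common_support HV hV w'V (or_introl adjw').
by rewrite gu0 (h_simple _ _ su0 su).
Qed.

(** If [k = g], every direction strictly between the first and the last one has
    [k] as its only support; so there is at most one. Otherwise [inner_gap] and
    its mirror image give the second and the fourth direction, and both describe
    the third one as the direction of [k - g]. *)
Lemma sector_le5 V a b : extremal_pair V a b -> exists2 L : seq vec,
  (size L <= 5)%N & forall z, z \in V -> inside a b z -> z \in L.
Proof.
move=> E; have HV := extremal_normals E.
have [x1 [g C]] := first_chord_exists E; have [x2 [k D]] := last_chord_exists E.
have [[x2V adj2 in2 s2a s2k] [ka hV bk0 k_second]] := last_chordP HV D.
have [x1V adj1 in1] := And3 (chord_dir C) (chord_adj C) (chord_inside C).
have after z : z \in V -> inside a b z -> z = x1 \/ 0 < det x1 z.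
  by move=> zV [az _]; apply: adjacent_next adj1 az.
have before z : z \in V -> inside a b z -> z = x2 \/ 0 < det z x2.
  by move=> zV [_ zb]; apply: adjacent_prev adj2 zb.
have [e|x12] := after _ x2V in2.
  exists [:: x1] => // z zV inz; rewrite inE; apply/eqP.
  have [//|h1] := after _ zV inz; have [->//|] := before _ zV inz.
  by rewrite e detC oppr_gt0 ltNge ltW.
have [ekg|kg] := eqVneq k g.
  have simple z : inside a b z -> 0 < det x1 z -> 0 < det z x2 -> simple_dir V z.
    move=> inz x1z zx2; suff supp u : supports V z u -> u = g.
      by move=> u u' /supp-> /supp->.
    move=> su; have [uV umax] := su; have [au bu] := support_inside E inz su.
    have gmax := umax _ (chord_in C).
    have ub : u != b.
      by apply/eqP => e; have := first_chord_beats E C x1z; rewrite -e ltNge gmax.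
    have ua : u != - a.
      by apply/eqP => e; have := last_chord_beats E D zx2; rewrite -e ekg ltNge gmax.
    have h1 := chord_second C uV ub; have h2 := k_second _ uV ua.
    rewrite ekg in h2; have M0 := extremal_gt0 E.
    have := plucker a b z u; have := plucker a b z g.
    rewrite (detC u b) (detC g b) !mulrN !opprK => h3 h4; case: inz => az zb.
    have [e1 e2] : det a u = det a g /\ det b u = det b g by split; clear -h1 h2 h3 h4 az zb M0 gmax; nia.
    by apply: (@det_inj a b) => //; [rewrite gt_eqF|rewrite (detC u) (detC g) e2].
  have [w [wV adjw hw]] := next_dir HV x1V x2V x12.
  have [e|wx2] := hw.
    exists [:: x1; x2] => // z zV inz; rewrite !inE.
    have [->|x1z] := after _ zV inz; first by rewrite eqxx.
    have [->|zx2] := before _ zV inz; first by rewrite eqxx orbT.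
    by case: adjw => _ /(_ _ zV x1z); rewrite e leNgt zx2.
  have x1w : 0 < det x1 w by case: adjw.
  have inw := inside_between in1 in2 x12 x1w wx2.
  have sw := simple _ inw x1w wx2.
  have [w' [w'V adjw' hw']] := next_dir HV wV x2V wx2.
  have [e|w'x2] := hw'; last first.
    have ww' : 0 < det w w' by case: adjw'.
    have inw' := inside_between inw in2 wx2 ww' w'x2.
    have x1w' : 0 < det x1 w' by have := three_term x1 w w' x2; clear -x1w w'x2 x12 ww' wx2; nia.
    by case: (simple_not_adjacent HV wV w'V (or_introl adjw') sw (simple _ inw' x1w' w'x2)).
  exists [:: x1; w; x2] => // z zV inz; rewrite !inE.
  have [->|x1z] := after _ zV inz; first by rewrite eqxx.
  have [->|wz] := adjacent_next HV wV zV adjw x1z; first by rewrite eqxx orbT.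
  have [->|zx2] := before _ zV inz; first by rewrite eqxx !orbT.
  by case: adjw' => _ /(_ _ zV wz); rewrite e leNgt zx2.
have [w [wV adj1h adjhw inw [swg swk]]] := inner_gap E C D x12 kg.
have C' : last_chord (map flip V) (flip b) (flip a) (flip x1) (- flip g).
  rewrite /last_chord !flipK flipN opprK flipK -map_comp.
  by rewrite (eq_map (g := id)) ?map_id // => y /=; rewrite flipK.
have [||w' [w'V]] := inner_gap (extremal_flip E) D C'.
- by rewrite det_flip -detC.
- by apply/eqP => /oppr_inj/(can_inj flipK) e; move: kg; rewrite e eqxx.
rewrite (_ : flip a - - flip g = flip (g + a)); last by rewrite opprK addrC.
rewrite !adjacent_flip !support_flip // !flipN !flipK !opprK => adj2h adjhw' inw' [sk' sg'].
have inw2 : inside a b (flip w').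
  case: inw' => h1 h2.
  by split; [rewrite detC det_flipl opprK|rewrite det_flipl -detC].
have ww' : flip w' = w.
  have swk' := conj sk' sg'; case: swk' => -[_ kmax'] [_ gmax'].
  have [[kV kmax] [gV gmax]] := (swk, swg).
  have e1 : det w k = det w g by apply/le_anti; rewrite gmax // kmax.
  have e2 : det (flip w') k = det (flip w') g by apply/le_anti; rewrite gmax' // kmax'.
  have [|s es] := normals_primitive HV (y := k - g) wV.
    by rewrite !detE e1 subrr.
  have : s * det (flip w') w = 0 by rewrite -detZr -es !detE e2 subrr.
  move/eqP; rewrite mulf_eq0 => /orP[/eqP s0|/eqP ww'].
    by move: kg; rewrite -subr_eq0 es s0 mulr0z eqxx.
  have [|//|e] := normals_parallel HV _ wV ww'; first by rewrite -mem_flip.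
  by case: inw2; rewrite e detNr oppr_gt0 ltNge (ltW inw.1).
exists [:: x1; b - k; w; g + a; x2] => // z zV inz; rewrite !inE.
have [->|x1z] := after _ zV inz; first by rewrite eqxx.
have [->|hz] := adjacent_next HV hV zV adj1h x1z; first by rewrite eqxx !orbT.
have [->|wz] := adjacent_next HV wV zV adjhw hz; first by rewrite eqxx !orbT.
have [->|zx2] := before _ zV inz; first by rewrite eqxx !orbT.
have [->|zg] := adjacent_prev HV (chord_shift C) zV adj2h zx2; first by rewrite eqxx !orbT.
by rewrite ww' in adjhw'; case: adjhw' => _ /(_ _ zV wz); rewrite leNgt zg.
Qed.



(** * The bound for systems of normals *)
Lemma simple_or_not V a b : supports V a b ->
  simple_dir V a \/ exists2 u, supports V a u & u != b.
Proof.
move=> [bV bmax].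
have [/hasP[u uV /andP[ub /eqP e]]|/hasPn none] :=
  boolP (has (fun u => (u != b) && (det a u == det a b)) V).
  by right; exists u => //; split=> // z zV; rewrite e bmax.
left; suff supp u : supports V a u -> u = b by move=> u u' /supp-> /supp->.
move=> [uV umax]; have := none _ uV; rewrite negb_and negbK => /orP[/eqP//|].
by rewrite eq_le bmax // umax.
Qed.

Lemma extremal_bound V a b : extremal_pair V a b -> exists2 L : seq vec,
  (size L <= 12)%N & forall z, z \in V -> z \in L \/ - z \in L.
Proof.
move=> E; have [HV aV bV M0 _ _ _] := E; have opp := normals_opp HV.
have [L1 size1 in1] := sector_le5 E.
have [L2 size2 in2] := sector_le5 (extremal_rot E).
have up z : z \in V -> 0 < det a z -> z \in a :: b :: L1 ++ L2 \/ - z \in a :: b :: L1 ++ L2.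
  move=> zV az; rewrite !inE !mem_cat.
  have [->|->|bz|zb] := det_cases HV bV zV.
  - by left; rewrite eqxx orbT.
  - by right; rewrite opprK eqxx orbT.
  - by left; rewrite (in2 z) ?orbT //; split; rewrite // detNr -detC.
  - by left; rewrite (in1 z) ?orbT.
exists (a :: b :: L1 ++ L2); first by rewrite /= size_cat; lia.
move=> z zV; have [->|->|az|za] := det_cases HV aV zV.
- by left; rewrite inE eqxx.
- by right; rewrite opprK inE eqxx.
- exact: up.
- have := up _ (opp _ zV); rewrite detNr -detC => /(_ za).
  by rewrite opprK; case; [right|left].
Qed.

Lemma normals_bound V : simplicial_normals V -> exists2 L : seq vec,
  (size L <= 12)%N & forall z, z \in V -> z \in L \/ - z \in L.
Proof.
move=> HV; have opp := normals_opp HV.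
case EV : V => [|v V']; first by exists [::].
have vV : v \in V by rewrite EV mem_head.
rewrite -EV; have [[a b] abP Mmax] := max_exists (fun p : vec * vec => det p.1 p.2)
  (allpairs_f pair vV vV).
move: abP => /allpairsP [[a' b'] /= [aV bV [ea eb]]].
move: aV bV Mmax; rewrite -{}ea -{}eb => aV bV Mmax {a' b'}.
have {}Mmax x y : x \in V -> y \in V -> det x y <= det a b.
  by move=> xV yV; apply: (Mmax (x, y)); apply: (allpairs_f pair xV yV).
have [M0|M0] := leP (det a b) 0.
  exists [:: v] => // z zV; rewrite !inE; have e : det z v = 0.
    apply/le_anti; rewrite (le_trans (Mmax _ _ zV vV)) //= -oppr_le0 -detNl.
    exact: le_trans (Mmax _ _ (opp _ zV) vV) M0.
  have [->|->] := normals_parallel HV zV vV e; first by left.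
  by right; rewrite opprK.
have sb : supports V a b by split=> // z; apply: Mmax.
have eM : det b (- a) = det a b by rewrite detNr -detC.
have sa : supports V b (- a) by split; [apply: opp|move=> z; rewrite eM; apply: Mmax].
have [simple_a|[u su ub]] := simple_or_not sb; last first.
  have [L sizeL] := hexagon_case HV aV bV M0 Mmax su ub.
  by exists L; first exact: leq_trans sizeL _.
have [simple_b|[u su ub]] := simple_or_not sa; first exact: (@extremal_bound V a b).
have [||L sizeL] := hexagon_case HV bV (opp _ aV) _ _ su ub; rewrite ?eM //.
by exists L; first exact: leq_trans sizeL _.
Qed.

(** * From simplicial cones to triangular cells *)

(** The point [(v, m)] is sent to the vector [(v.2, - v.1, m)] of the upper half
    space. The quarter turn replaces the inner product with a normal [u] by the
    determinant: the plane orthogonal to [u + k e3] contains this vector exactly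
    when [det v u = k * m]. *)
Definition plane_form (R : realType) (u : vec) (k : int) (x : 'rV[R]_3) : R :=
  x 0 0 * u.1%:~R + x 0 1 * u.2%:~R + x 0 ord_max * k%:~R.

Definition normal_vec (v : 'rV[int]_2) : vec := (v 0 0, v 0 1).

Lemma inner_coord (R : realType) (x y : 'rV[R]_3) :
  inner x y = x 0 0 * y 0 0 + x 0 1 * y 0 1 + x 0 ord_max * y 0 ord_max.
Proof.
rewrite /inner !big_ord_recl big_ord0 addr0 addrA.
have -> : lift ord0 (ord0 : 'I_2) = 1 by apply/val_inj.
by have -> : lift ord0 (lift ord0 (ord0 : 'I_1)) = ord_max by apply/val_inj.
Qed.

Lemma inner_plane (R : realType) (v : 'rV[int]_2) k (x : 'rV[R]_3) :
  inner x (plane_to_space (real_vec R v) + k%:~R *: e3 R) =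
  plane_form (normal_vec v) k x.
Proof.
rewrite inner_coord /plane_form /plane_to_space /real_vec /e3.
have e0 : lshift 1 (0 : 'I_2) = 0 by apply/val_inj.
have e1 : lshift 1 (1 : 'I_2) = 1 by apply/val_inj.
have e2 : rshift 2 (0 : 'I_1) = ord_max by apply/val_inj.
have := row_mxEl (map_mx intr v) (0 : 'rV[R]_1) 0 0; rewrite e0 => r0.
have := row_mxEl (map_mx intr v) (0 : 'rV[R]_1) 0 1; rewrite e1 => r1.
have := row_mxEr (map_mx intr v) (0 : 'rV[R]_1) 0 0; rewrite e2 => r2.
have D (A B : 'rV[R]_3) j : (A + B) 0 j = A 0 j + B 0 j by rewrite mxE.
by rewrite !D r0 r1 r2 !mxE !eqxx /= !mulr0 !mulr1 !addr0 add0r.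
Qed.

Lemma plane_formD (R : realType) u k (x y : 'rV[R]_3) :
  plane_form u k (x + y) = plane_form u k x + plane_form u k y.
Proof. by rewrite /plane_form !mxE; ring. Qed.

Lemma plane_formZ (R : realType) u k c (x : 'rV[R]_3) :
  plane_form u k (c *: x) = c * plane_form u k x.
Proof. by rewrite /plane_form !mxE; ring. Qed.

Lemma plane_formN (R : realType) u k (x : 'rV[R]_3) :
  plane_form (- u) (- k) x = - plane_form u k x.
Proof. by rewrite /plane_form /= !mulrNz; ring. Qed.

Lemma plane_form_sum (R : realType) u k n (F : 'I_n -> 'rV[R]_3) :
  plane_form u k (\sum_i F i) = \sum_i plane_form u k (F i).
Proof.
elim/big_rec2: _ => [|i y x _ <-]; last by rewrite plane_formD.
by rewrite /plane_form !mxE; ring.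
Qed.

Lemma plane_form_continuous (R : realType) u k :
  continuous (@plane_form R u k).
Proof.
have cM (j : 'I_3) (z : int) : continuous (fun x : 'rV[R]_3 => x 0 j * z%:~R).
  by move=> x; exact: (cvgM (coord_continuous (x := x)) (cvg_cst _)).
by move=> x; exact: (cvgD (cvgD (cM _ _ x) (cM _ _ x)) (cM _ _ x)).
Qed.

Definition point_row (R : realType) (P : rat_point) : 'rV[R]_3 :=
  \row_j (if j == 0 then P.1.2%:~R else if j == 1 then - P.1.1%:~R else P.2%:~R).

Lemma plane_form_point (R : realType) u k P :
  plane_form u k (point_row R P) = (k * P.2 - det P.1 u)%:~R.
Proof.
rewrite /plane_form /point_row !mxE /= /det !intrB !intrM; ring.
Qed.

Lemma ge0_of_small_pert (R : realType) (x y : R) :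
  (forall t, 0 < t -> 0 < x + t * y) -> 0 <= x.
Proof.
move=> h; rewrite leNgt; apply/negP => x0.
have y0 : 0 < y by have := h 1 ltr01; lra.
have := h (- x / y); rewrite divfK ?gt_eqF // subrr ltxx => /(_ _) f.
by apply/notF/f; rewrite divr_gt0 // oppr_gt0.
Qed.

Lemma connected_pos (R : realType) (T : topologicalType) (C : set T) (f : T -> R) x :
  connected C -> continuous f -> C x -> 0 < f x -> (forall y, C y -> f y != 0) ->
  forall y, C y -> 0 < f y.
Proof.
move=> cC cf Cx fx f0 y Cy.
have := connected_continuous_connected cC (continuous_subspaceT cf).
move=> /connected_intervalP itv.
rewrite ltNge; apply/negP => fy.
have [z Cz /eqP] : (f @` C) 0.
  by apply: (itv (f y) (f x)); [exists y|exists x|rewrite fy ltW].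
by rewrite (negbTE (f0 _ Cz)).
Qed.

Lemma segment_connected (R : realType) (p q : 'rV[R]_3) :
  connected ((fun t : R => p + t *: q) @` [set t | 0 < t]).
Proof.
apply: connected_continuous_connected.
  by apply/connected_intervalP => s t /= s0 t0 r /andP[sr _]; apply: lt_le_trans sr.
apply: continuous_subspaceT => t; exact: (cvgD (cvg_cst p) (@scalel_continuous R 'rV[R]_3 q t)).
Qed.

Definition normals n (v : 'I_n -> 'rV[int]_2) : seq vec :=
  [seq normal_vec (v i) | i <- enum 'I_n] ++ [seq - normal_vec (v i) | i <- enum 'I_n].

Lemma mem_normals n (v : 'I_n -> 'rV[int]_2) x : x \in normals v <->
  exists i, x = normal_vec (v i) \/ x = - normal_vec (v i).
Proof.
rewrite mem_cat; split.
  by case/orP=> /mapP [i _ ->]; exists i; [left|right].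
by case=> i [|] ->; apply/orP; [left|right]; apply/mapP; exists i; rewrite ?mem_enum.
Qed.

Lemma normals_oppr n (v : 'I_n -> 'rV[int]_2) x : x \in normals v -> - x \in normals v.
Proof.
move=> /mem_normals [i] [] ->; apply/mem_normals; exists i; first by right.
by left; rewrite opprK.
Qed.

Lemma complementP (R : realType) n (v : 'I_n -> 'rV[int]_2) (x : 'rV[R]_3) :
  arrangement_complement (toric_arrangement R v) x <->
  0 < x 0 ord_max /\ forall u k, u \in normals v -> plane_form u k x != 0.
Proof.
split=> -[x0 h]; split=> //.
  have hi i k : plane_form (normal_vec (v i)) k x != 0.
    apply/eqP => e; apply: h.
    exists (orthogonal_complement
      (plane_to_space (real_vec R (v i)) + k%:~R *: e3 R)); first by left; exists i, k.
    by rewrite /orthogonal_complement /= inner_plane.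
  move=> u k /mem_normals [i [|]] ->; first exact: hi.
  by rewrite -[k]opprK plane_formN oppr_eq0.
case=> H [[i [k ->]]|->]; rewrite /orthogonal_complement /=.
  by rewrite inner_plane; apply/eqP/h; apply/mem_normals; exists i; left.
rewrite inner_coord /e3 !mxE !eqxx /= !mulr0 !add0r mulr1 => e.
by move: x0; rewrite /upper_half_space /= e ltxx.
Qed.

(** Two planes with independent horizontal parts meet in a line that is not
    horizontal, so a vector of this line is determined by its height. *)
Lemma plane_form_kernel (R : realType) u k u' k' (p y : 'rV[R]_3) :
  det u u' != 0 -> plane_form u k p = 0 -> plane_form u' k' p = 0 ->
  plane_form u k y = 0 -> plane_form u' k' y = 0 ->
  p 0 ord_max *: y = y 0 ord_max *: p.
Proof.
move=> uu' hp hp' hy hy'; pose z := p 0 ord_max *: y - y 0 ord_max *: p.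
suff : z = 0 by move/eqP; rewrite subr_eq0 => /eqP.
have form0 w k0 : plane_form w k0 p = 0 -> plane_form w k0 y = 0 ->
    z 0 0 * w.1%:~R + z 0 1 * w.2%:~R = 0.
  move=> wp wy.
  have : p 0 ord_max * plane_form w k0 y - y 0 ord_max * plane_form w k0 p = 0.
    by rewrite wp wy !mulr0 subrr.
  by move=> <-; rewrite /plane_form /z !mxE; ring.
have h := form0 _ _ hp hy; have h' := form0 _ _ hp' hy'.
have d0 : (det u u')%:~R != 0 :> R by rewrite intr_eq0.
have z0 : z 0 0 = 0.
  apply: (mulIf d0); rewrite mul0r.
  transitivity ((z 0 0 * u.1%:~R + z 0 1 * u.2%:~R) * u'.2%:~R
    - (z 0 0 * u'.1%:~R + z 0 1 * u'.2%:~R) * u.2%:~R).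
    by rewrite /det !intrB !intrM; ring.
  by rewrite h h' !mul0r subrr.
have z1 : z 0 1 = 0.
  apply: (mulIf d0); rewrite mul0r.
  transitivity ((z 0 0 * u'.1%:~R + z 0 1 * u'.2%:~R) * u.1%:~R
    - (z 0 0 * u.1%:~R + z 0 1 * u.2%:~R) * u'.1%:~R).
    by rewrite /det !intrB !intrM; ring.
  by rewrite h h' !mul0r subrr.
have z2 : z 0 ord_max = 0 by rewrite /z !mxE; ring.
apply/rowP => j; rewrite [RHS]mxE.
have [->|->|->] : [\/ j = 0, j = 1 | j = ord_max] => //.
by case: j => -[|[|[|//]]] ij; [constructor 1|constructor 2|constructor 3]; apply/val_inj.
Qed.

(** The generators of the cone that occur in [p] lie on both planes through [p],
    as these planes do not cut the cone. So they are all proportional to [p], and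
    there is only one of them. *)
Lemma vertex_extreme (R : realType) (b : 3.-tuple 'rV[R]_3) (p : 'rV[R]_3) u k u' k' :
  free b -> (forall l, 0 <= coord b l p) -> p = \sum_l coord b l p *: tnth b l ->
  0 < p 0 ord_max -> det u u' != 0 ->
  plane_form u k p = 0 -> plane_form u' k' p = 0 ->
  (forall l, 0 <= plane_form u k (tnth b l)) ->
  (forall l, 0 <= plane_form u' k' (tnth b l)) ->
  forall l l', 0 < coord b l p -> 0 < coord b l' p -> l = l'.
Proof.
move=> fb c0 ep p0 uu' hp hp' hb hb' l l' cl cl'.
have vanish w k0 : plane_form w k0 p = 0 ->
    (forall j, 0 <= plane_form w k0 (tnth b j)) -> plane_form w k0 (tnth b l) = 0.
  move=> wp wb; move: (wp); rewrite {1}ep plane_form_sum => /eqP.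
  rewrite psumr_eq0; last by move=> j _; rewrite plane_formZ mulr_ge0.
  move=> /allP /(_ l (mem_index_enum _)) /=; rewrite plane_formZ mulf_eq0.
  by rewrite gt_eqF //= => /eqP.
have bp := plane_form_kernel uu' hp hp' (vanish _ _ hp hb) (vanish _ _ hp' hb').
apply/eqP/negP => /negP ll'.
have cE j : coord b j (tnth b l) = (l == j)%:R by rewrite (tnth_nth 0) coord_free.
have := congr1 (coord b l') bp; rewrite !linearZ /= !cE (negbTE ll') mulr0.
move/esym/eqP; rewrite mulf_eq0 (gt_eqF cl') orbF => /eqP b0.
have := congr1 (coord b l) bp; rewrite !linearZ /= !cE eqxx mulr1 b0 mul0r => e.
by move: p0; rewrite e ltxx.
Qed.

Lemma free_tuple_sum (R : realType) (b : 3.-tuple 'rV[R]_3) (c : 'I_3 -> R) l :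
  free b -> coord b l (\sum_i c i *: tnth b i) = c l.
Proof.
move=> fb; rewrite -(coord_sum_free c l fb); congr coord.
by apply: eq_bigr => i _; rewrite (tnth_nth 0).
Qed.

(** Let [p] and [q] be two vertices that contradict the claim. No plane of the
    arrangement contains [p + q] or cuts the segment between [p] and [q], so both
    are in the closure of the cell of [p + q]. Each of them involves only one
    generator of this cell, but their sum involves all three. *)
Lemma triangular_of_simplicial (R : realType) n (v : 'I_n -> 'rV[int]_2) :
  simplicial (toric_arrangement R v) -> triangular_cells (normals v).
Proof.
move=> simp P Q P0 Q0 VP VQ; apply: contrapT => none.
pose p := point_row R P; pose q := point_row R Q.
(* Up to sign, the form of every plane is nonnegative at [p] and at [q], and
   positive at one of them. *)
have same_side u k : u \in normals v ->
    (0 <= plane_form u k p) && (0 < plane_form u k q) ||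
    (0 < plane_form u k p) && (0 <= plane_form u k q) ||
    ((plane_form u k p <= 0) && (plane_form u k q < 0) ||
    (plane_form u k p < 0) && (plane_form u k q <= 0)).
  move=> uV; rewrite !plane_form_point !ler0z !ltr0z !lerz0 !ltrz0.
  apply/negPn/negP => h; apply: none.
  have [[e1 e2]|[h1|h1]] : (det P.1 u = k * P.2 /\ det Q.1 u = k * Q.2) \/
      (det P.1 u < k * P.2 /\ k * Q.2 < det Q.1 u) \/
      (k * P.2 < det P.1 u /\ det Q.1 u < k * Q.2) by lia.
  - by exists u, k; split=> //; left.
  - by exists u, k; split=> //; right.
  - exists (- u), (- k); split; first exact: normals_oppr.
    by right; rewrite /strictly_below /strictly_above !detNr !mulNr !ltrN2; case: h1.
have pos s t : 0 < s -> 0 < t ->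
    arrangement_complement (toric_arrangement R v) (s *: p + t *: q).
  move=> s0 t0; apply/complementP; split.
    by rewrite !mxE /= addr_gt0 // mulr_gt0 // ltr0z.
  move=> u k uV; rewrite plane_formD !plane_formZ.
  by have := same_side u k uV; nra.
pose A := arrangement_complement (toric_arrangement R v).
pose x := p + q; have Ax : A x by have := pos 1 1 ltr01 ltr01; rewrite !scale1r.
pose C := connected_component A x.
have Cx : C x by apply: connected_component_refl.
have CA : C `<=` A by apply: connected_component_sub.
have seg_p t : 0 < t -> C (p + t *: q).
  move=> t0; apply: (@connected_component_max _ _ ((fun t : R => p + t *: q) @` [set t | 0 < t])).
  - by exists 1; rewrite //= scale1r.
  - by move=> _ [s s0 <-]; have := pos 1 s ltr01 s0; rewrite scale1r.
  - exact: segment_connected.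
  - by exists t.
have seg_q t : 0 < t -> C (q + t *: p).
  move=> t0; apply: (@connected_component_max _ _ ((fun t : R => q + t *: p) @` [set t | 0 < t])).
  - by exists 1; rewrite //= scale1r addrC.
  - by move=> _ [s s0 <-]; have := pos s 1 s0 ltr01; rewrite scale1r addrC.
  - exact: segment_connected.
  - by exists t.
have [b [bb eC]] := simp x Ax; rewrite -/A -/C in eC.
have fb : free b by apply: basis_free bb.
have expand y : y = \sum_l coord b l y *: tnth b l.
  rewrite {1}(coord_basis bb (memvf y)); apply: eq_bigr => i _.
  by rewrite (tnth_nth 0).
have coordC y l : C y -> 0 < coord b l y.
  by rewrite eC => -[c [c0 ->]]; rewrite free_tuple_sum.
have cp l : 0 <= coord b l p.
  apply: (@ge0_of_small_pert _ _ (coord b l q)) => t t0.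
  by have := coordC _ l (seg_p t t0); rewrite linearD linearZ.
have cq l : 0 <= coord b l q.
  apply: (@ge0_of_small_pert _ _ (coord b l p)) => t t0.
  by have := coordC _ l (seg_q t t0); rewrite linearD linearZ.
have sides u k : u \in normals v -> 0 < plane_form u k x ->
    forall l, 0 <= plane_form u k (tnth b l).
  move=> uV ux l; apply: (@ge0_of_small_pert _ _ (plane_form u k (\sum_i tnth b i))) => t t0.
  rewrite -plane_formZ -plane_formD.
  apply: (connected_pos (@component_connected _ A x) (@plane_form_continuous R u k) Cx ux).
    by move=> y /CA /complementP [_]; apply.
  rewrite -/C eC; exists (fun i => (i == l)%:R + t); split.
    by move=> i; rewrite ltr_wpDl // ler0n.
  under [RHS]eq_bigr do rewrite scalerDl.
  rewrite big_split /= -scaler_sumr; congr (_ + _).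
  rewrite (bigD1 l) //= eqxx scale1r big1 ?addr0 // => i /negbTE ->.
  by rewrite scale0r.
have [_ x0] := (complementP _ _).1 Ax.
have towards_x u k : u \in normals v -> exists w j, [/\ w \in normals v,
    0 < plane_form w j x & (w, j) = (u, k) \/ (w, j) = (- u, - k)].
  move=> uV; have [h|h|/eqP] := ltgtP 0 (plane_form u k x).
  - by exists u, k; split=> //; left.
  - exists (- u), (- k); split; [exact: normals_oppr| |by right].
    by rewrite plane_formN oppr_gt0.
  - by rewrite eq_sym (negbTE (x0 _ _ uV)).
have one_ray (S : rat_point) : 0 < S.2 -> is_vertex (normals v) S ->
    (forall l, 0 <= coord b l (point_row R S)) -> forall l l',
    0 < coord b l (point_row R S) -> 0 < coord b l' (point_row R S) -> l = l'.
  move=> S0 [u [k [u' [k' [uV u'V uu' hu hu']]]]] cS.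
  have [w [j [wV wx ew]]] := towards_x u k uV.
  have [w' [j' [w'V w'x ew']]] := towards_x u' k' u'V.
  have zero y i : on_line S y i -> plane_form y i (point_row R S) = 0.
    by rewrite plane_form_point => ->; rewrite subrr.
  apply: (vertex_extreme fb cS (expand _) _ _ _ _ (sides w j wV wx) (sides w' j' w'V w'x)).
  - by rewrite mxE ltr0z.
  - by case: ew ew' => -[-> _] [] [-> _]; rewrite ?detNl ?detNr ?opprK ?oppr_eq0.
  - by case: ew => -[-> ->]; rewrite ?plane_formN (zero _ _ hu) ?oppr0.
  - by case: ew' => -[-> ->]; rewrite ?plane_formN (zero _ _ hu') ?oppr0.
have inj_p := one_ray P P0 VP cp.
have inj_q := one_ray Q Q0 VQ cq.
have some l : 0 < coord b l p \/ 0 < coord b l q.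
  have := coordC _ l Cx; rewrite linearD /=; have := cp l; have := cq l.
  rewrite le_eqVlt => /orP[/eqP <-|]; last by right.
  by rewrite addr0; left.
have l01 : 0 <> 1 :> 'I_3 by [].
have l02 : 0 <> ord_max :> 'I_3 by [].
have l12 : 1 <> ord_max :> 'I_3 by [].
case: (some 0) (some 1) (some ord_max) => h0 [] h1 [] h2;
  by [case: (l01 (inj_p _ _ h0 h1))|case: (l01 (inj_q _ _ h0 h1))
     |case: (l02 (inj_p _ _ h0 h2))|case: (l02 (inj_q _ _ h0 h2))
     |case: (l12 (inj_p _ _ h1 h2))|case: (l12 (inj_q _ _ h1 h2))].
Qed.

Lemma det_of_indep (R : realType) n (v : 'I_n -> 'rV[int]_2) i j :
  pairwise_lin_indep R v -> (forall i, gcdz (v i 0 0) (v i 0 1) = 1) ->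
  det (normal_vec (v i)) (normal_vec (v j)) = 0 -> i = j.
Proof.
move=> indep gcd1 ij0; apply/eqP/negP => /negP /indep.
move=> /(@freeP _ _ 2 [tuple real_vec R (v i); real_vec R (v j)]) fr.
(* In each coordinate [c], the vanishing determinant is a linear relation whose
   coefficients are the entries [c] of [v j] and [v i]. *)
have vi0 c : v i 0 c = 0.
  have := fr (fun l => if l == 0 then (v j 0 c)%:~R else - (v i 0 c)%:~R).
  move=> /(_ _ 1) /= h; suff /h/eqP : \sum_(l < 2)
      (if l == 0 then (v j 0 c)%:~R else - (v i 0 c)%:~R) *:
      [tuple real_vec R (v i); real_vec R (v j)]`_l = 0.
    by rewrite oppr_eq0 intr_eq0 => /eqP.
  rewrite !big_ord_recl big_ord0 /= addr0; apply/rowP => d; rewrite !mxE.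
  rewrite mulNr -!intrM -intrB; apply/eqP; rewrite intr_eq0; apply/eqP.
  move: ij0; rewrite /det /= => ij0.
  have two (e : 'I_2) : e = 0 \/ e = 1.
    by case: e => -[|[|//]] ie; [left|right]; apply/val_inj.
  by case: (two c) => ->; case: (two d) => ->; lia.
by have := gcd1 i; rewrite !vi0.
Qed.

Lemma normals_simplicial (R : realType) n (v : 'I_n -> 'rV[int]_2) :
  pairwise_lin_indep R v -> (forall i, gcdz (v i 0 0) (v i 0 1) = 1) ->
  simplicial (toric_arrangement R v) -> simplicial_normals (normals v).
Proof.
move=> indep gcd1 simp; split.
- exact: normals_oppr.
- move=> x y /mem_normals [i hx] /mem_normals [j hy] xy.
  suff eij : i = j.
    by move: hx hy; rewrite eij => -[->|->] [->|->]; rewrite ?opprK; by [left|right].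
  apply: (det_of_indep indep gcd1); apply/eqP; move/eqP: xy.
  by case: hx hy => -> [] ->; rewrite ?detNl ?detNr ?opprK ?oppr_eq0.
- move=> x y /mem_normals [i hx] xy.
  have [s es] : exists s, y = normal_vec (v i) *~ s.
    have : det (normal_vec (v i)) y = 0.
      by apply/eqP; move/eqP: xy; case: hx => ->; rewrite ?detNl ?oppr_eq0.
    have [c [d]] := Bezoutz (v i 0 0) (v i 0 1); rewrite gcd1 /det /= => cd h.
    exists (y.1 * c + y.2 * d); rewrite [LHS]surjective_pairing [RHS]surjective_pairing.
    rewrite (raddfMz fst) (raddfMz snd) /= !mulrzz.
    congr pair.
      transitivity (y.1 * (c * v i 0 0 + d * v i 0 1)
        + d * (v i 0 0 * y.2 - v i 0 1 * y.1)); last by ring.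
      by rewrite cd h mulr1 mulr0 addr0.
    transitivity (y.2 * (c * v i 0 0 + d * v i 0 1)
      - c * (v i 0 0 * y.2 - v i 0 1 * y.1)); last by ring.
    by rewrite cd h mulr1 mulr0 subr0.
  by case: hx => ->; [exists s|exists (- s); rewrite mulrNz mulNrz opprK].
- exact: triangular_of_simplicial simp.
Qed.

Theorem theorem1p2 (R : realType) (n : nat) (v : 'I_n -> 'rV[int]_2)
    (v_indep : pairwise_lin_indep R v)
    (v_gcd : forall i, gcdz (v i 0 0) (v i 0 1) = 1)
    (A_simplicial : simplicial (toric_arrangement R v)) :
  (n <= 12)%N.
Proof.
have HV := normals_simplicial v_indep v_gcd A_simplicial.
have [L sizeL coverL] := normals_bound HV.
pose rep i := if normal_vec (v i) \in L then normal_vec (v i) else - normal_vec (v i).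
have rep_inj : injective rep.
  move=> i j; rewrite /rep => eij; apply: (det_of_indep v_indep v_gcd); apply/eqP.
  have : det (rep i) (rep j) == 0 by rewrite /rep eij detxx.
  by rewrite /rep; do 2 case: ifP => _; rewrite ?detNl ?detNr ?opprK ?oppr_eq0.
have := @uniq_leq_size _ [seq rep i | i <- enum 'I_n] L.
rewrite map_inj_uniq // enum_uniq size_map size_enum_ord => le.
apply: leq_trans (le _ _) sizeL => // x /mapP [i _ ->]; rewrite /rep.
have iV : normal_vec (v i) \in normals v by apply/mem_normals; exists i; left.
by case: ifP => // notL; case: (coverL _ iV) => //; rewrite notL.
Qed.
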